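(* Let $d\ge 1$ and $r\ge 1$ be integers. Then, as formal power series in $x$, $$\sum_{n\ge 1}\mu(Q_{dn}(dr,d,d,\{0\}))\cdot\frac{x^n d^n}{(dn)!\,r^{(d-1)n}}=-\left(\sum_{n\ge 1}\frac{x^n d^n}{(dn)!\,r^{(d-1)n}}\right)\left(\sum_{n\ge 0}\frac{x^n d^n r^n}{(n!)^{d}}\right)^{-\frac{1}{dr}}.$$
   Context: For a finite bounded poset $P$, $\mu(P)=\mu_P(\hat 0,\hat 1)$, where $\mu_P$ is the Möbius function. Dowling lattices. Write $[N]=\{1,\dots,N\}$, and identify the group $\mu_s$ of complex $s$-th roots of unity with $\mathbb{Z}/s\mathbb{Z}$. A $\mu_s$-prepartition is a triple $(I,\pi,\lambda)$, where $I\subseteq[N]$ (the zero block, possibly empty), $\pi=B_1\mid\cdots\mid B_l$ is a partition of $[N]\setminus I$ into nonempty blocks (the nonzero blocks), and $\lambda:[N]\setminus I\to\mu_s$ is a map. Two prepartitions are equivalent if they have the same $I$ and the same $\pi$ and, for each block $B_i$, their labellings restricted to $B_i$ differ by multiplication by a constant of $\mu_s$ (depending on the block). The elements of $Q_N(s)$ are the equivalence classes. The partial order is generated by the covering relations: $\alpha$ is covered by $\beta$ if $\beta$ is obtained from $\alpha$ either by merging a nonzero block $B_i$ into the zero block, or by merging two nonzero blocks $B_i,B_j$ into one block $B_i\cup B_j$ with labelling $\lambda$ on $B_i$ and $\lambda\cdot g$ on $B_j$ for some $g\in\mu_s$. The minimum $\hat 0$ of $Q_N(s)$ has $I=\emptyset$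 and all nonzero blocks singletons; the maximum $\hat 1$ has $I=[N]$. For $k\mid s$, $k\mid d$ and $J\subseteq\{0,\dots,N\}$, $Q_N(s,d,k,J)$ is the subposet of $Q_N(s)$ consisting of $\hat 0$ together with the elements such that $|I|\notin J$ and all nonzero blocks $B_i$ have size divisible by $d$ with $|\{a\in B_i\mid\lambda(a)\equiv j\pmod k\}|$ independent of $j$. *)

(* Defs.v *)
From HB Require Import structures.
From mathcomp Require Import all_boot all_order all_algebra.

Set Implicit Arguments.
Unset Strict Implicit.
Unset Printing Implicit Defensive.

Import Order.TTheory GRing.Theory Num.Theory.
Local Open Scope ring_scope.
Local Open Scope quotient_scope.

Section Mobius.
Variables (disp : Order.disp_t) (T : finPOrderType disp) (A : {set T}).

(* The fuel [n] is an upper bound on the number of elements of [A] in the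
   interval [x, y[; [mobius_eq] shows that #|A| is always enough. *)
Fixpoint mobius_rec (n : nat) (x y : T) : int :=
  if x == y then 1 else
  if n is n'.+1 then
    if (x < y)%O then - \sum_(z in A | (x <= z < y)%O) mobius_rec n' x z else 0
  else 0.

(* Moebius function of the subposet [A] of [T] with the induced order
   (meaningful for x and y in A). *)
Definition mobius (x y : T) : int := mobius_rec #|A| x y.

Lemma mobius_recE (n m : nat) (x y : T) :
  (#|[set z in A | (x <= z < y)%O]| <= n)%N -> (n <= m)%N -> x \in A ->
  mobius_rec n x y = mobius_rec m x y.
Proof.
elim: n m y => [|n IHn] [|m] y //= le_n le_nm xA.
  case: eqP => // _; case: ifP => // lt_xy.
  by move: le_n; rewrite leqn0 cards_eq0 => /eqP/setP/(_ x); rewrite !inE xA lexx lt_xy.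
case: eqP => // _; case: ifP => // lt_xy; congr (- _); apply: eq_bigr => z.
case/and3P=> zA le_xz lt_zy; apply: IHn => //.
rewrite -ltnS; apply: leq_trans le_n; apply/proper_card/properP; split.
  apply/subsetP=> t; rewrite !inE => /and3P[-> -> lt_tz] /=.
  exact: lt_trans lt_zy.
by exists z; rewrite !inE ?zA ?le_xz ?lt_zy //= ltxx.
Qed.

Lemma mobius_eq (x y : T) : x \in A ->
  mobius x y = if x == y then 1 else
               if (x < y)%O then - \sum_(z in A | (x <= z < y)%O) mobius x z
               else 0.
Proof.
move=> xA; rewrite /mobius (@mobius_recE _ #|A|.+1 x y) //=.
by apply/subset_leq_card/subsetP => z; rewrite inE => /andP[].
Qed.

End Mobius.

(* The cyclic group of s-th roots of unity, written additively, for s > 0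
   ('Z_s is not suitable here: it has two elements when s = 1). *)
Definition zmod (s : nat) : finZmodType := 'I_s.-1.+1.

Section Dowling.
Variables N s : nat.

(* [lab] is defined on all of 'I_N; its values on the zero block are
   irrelevant because [prepart_equiv] ignores them. *)
Record prepart := Prepart {
  prepart_val : {set 'I_N} * {set {set 'I_N}} * {ffun 'I_N -> zmod s};
  _ : partition prepart_val.1.2 (~: prepart_val.1.1)
}.

HB.instance Definition _ := [isSub for prepart_val].
HB.instance Definition _ := [Finite of prepart by <:].

Definition zero_block (p : prepart) : {set 'I_N} := (val p).1.1.
Definition blocks (p : prepart) : {set {set 'I_N}} := (val p).1.2.
Definition lab (p : prepart) : {ffun 'I_N -> zmod s} := (val p).2.

Definition prepart_equiv (p q : prepart) : bool :=
  [&& zero_block p == zero_block q, blocks p == blocks q &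
      [forall B in blocks p, exists g : zmod s,
         forall a in B, lab q a == lab p a + g]].

Lemma prepart_equiv_refl : reflexive prepart_equiv.
Proof.
move=> p; rewrite /prepart_equiv !eqxx /=; apply/forall_inP => B _.
by apply/existsP; exists 0; apply/forall_inP => a _; rewrite addr0.
Qed.

Lemma prepart_equiv_sym : symmetric prepart_equiv.
Proof.
suff sub p q : prepart_equiv p q -> prepart_equiv q p.
  by move=> p q; apply/idP/idP; apply: sub.
case/and3P=> /eqP eqI /eqP eqB /forall_inP eql.
rewrite /prepart_equiv eqI eqB !eqxx /=; apply/forall_inP => B Bq.
have /existsP[g /forall_inP gP] : [exists g : zmod s,
    forall a in B, lab q a == lab p a + g] by apply: eql; rewrite eqB.
apply/existsP; exists (- g); apply/forall_inP => a /gP/eqP ->.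
by rewrite addrK.
Qed.

Lemma prepart_equiv_trans : transitive prepart_equiv.
Proof.
move=> q p r /and3P[/eqP eqI /eqP eqB /forall_inP pq].
case/and3P=> /eqP eqI' /eqP eqB' /forall_inP qr.
rewrite /prepart_equiv eqI eqB eqI' eqB' !eqxx /=; apply/forall_inP => B Br.
have /existsP[g /forall_inP gP] : [exists g : zmod s,
    forall a in B, lab q a == lab p a + g] by apply: pq; rewrite eqB eqB'.
have /existsP[h /forall_inP hP] : [exists g : zmod s,
    forall a in B, lab r a == lab q a + g] by apply: qr; rewrite eqB'.
apply/existsP; exists (g + h); apply/forall_inP => a aB.
by rewrite (eqP (hP a aB)) (eqP (gP a aB)) addrA.
Qed.

Canonical prepart_equiv_rel :=
  EquivRel prepart_equiv prepart_equiv_refl prepart_equiv_sym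
           prepart_equiv_trans.

Definition dowling := {eq_quot prepart_equiv_rel}.
HB.instance Definition _ := EqQuotient.on dowling.
HB.instance Definition _ := Countable.on dowling.
HB.instance Definition _ : isFinite dowling := CanIsFinite (@reprK _ dowling).

Definition merge_zero (p q : prepart) : bool :=
  [exists B in blocks p,
    [&& zero_block q == zero_block p :|: B,
        blocks q == blocks p :\ B &
        [forall a in ~: zero_block q, lab q a == lab p a]]].

Definition merge_nonzero (p q : prepart) : bool :=
  [exists B1 in blocks p, exists B2 in blocks p, exists g : zmod s,
    [&& B1 != B2,
        zero_block q == zero_block p,
        blocks q == (B1 :|: B2) |: (blocks p :\ B1 :\ B2) &
        [forall a in ~: zero_block q,
           lab q a == if a \in B2 then lab p a + g else lab p a]]].

Definition dowling_cover (x y : dowling) : bool :=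
  [exists p : prepart, exists q : prepart,
    [&& \pi_dowling p == x, \pi_dowling q == y &
        merge_zero p q || merge_nonzero p q]].

Definition dowling_le : rel dowling := connect dowling_cover.

Lemma dowling_cover_card (x y : dowling) : dowling_cover x y ->
  (#|blocks (repr y)| < #|blocks (repr x)|)%N.
Proof.
have blocks_pi p : blocks (repr (\pi_dowling p)) = blocks p.
  have /eqmodP/and3P[_ /eqP-> _] //: repr (\pi_dowling p) = p %[mod dowling].
  by rewrite reprK.
case/existsP=> p /existsP[q /and3P[/eqP <- /eqP <-]].
rewrite !blocks_pi => /orP[/exists_inP[B Bp /and3P[_ /eqP -> _]]|].
  by rewrite (cardsD1 B (blocks p)) Bp.
case/exists_inP=> B1 B1p /exists_inP[B2 B2p /existsP[g]].
case/and4P=> neB _ /eqP -> _.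
rewrite (cardsD1 B1 (blocks p)) B1p (cardsD1 B2 (blocks p :\ B1)).
by rewrite !inE eq_sym neB B2p /= cardsU1 ltnS leq_add2r leq_b1.
Qed.

Lemma dowling_le_refl : reflexive dowling_le.
Proof. by move=> x; apply: connect0. Qed.

Lemma dowling_le_trans : transitive dowling_le.
Proof. by move=> y x z; apply: connect_trans. Qed.

Lemma dowling_le_card (x y : dowling) : dowling_le x y ->
  x = y \/ (#|blocks (repr y)| < #|blocks (repr x)|)%N.
Proof.
case/connectP=> w; elim: w x => [|z w IHw] x /=; first by left.
case/andP=> /dowling_cover_card lt_zx zw yE; right.
by case: (IHw z zw yE) => [<- // | lt_yz]; apply: ltn_trans lt_zx.
Qed.

Lemma dowling_le_anti : antisymmetric dowling_le.
Proof.
move=> x y /andP[/dowling_le_card[// | lt_yx] /dowling_le_card[// | lt_xy]].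
by have := ltn_trans lt_yx lt_xy; rewrite ltnn.
Qed.

HB.instance Definition _ := Order.Le_isPOrder.Build (Order.Disp tt tt)
  dowling dowling_le_refl dowling_le_anti dowling_le_trans.

Lemma prepart0_subproof :
  partition [set [set a] | a : 'I_N] (~: (set0 : {set 'I_N})).
Proof.
apply/and3P; split.
- rewrite eqEsubset setC0 subsetT; apply/subsetP => a _.
  by apply/bigcupP; exists [set a]; rewrite ?inE // imset_f.
- apply/trivIsetP => _ _ /imsetP[a _ ->] /imsetP[b _ ->] neq.
  by rewrite disjoints1 inE; apply: contra neq => /eqP->.
- by apply/imsetP => -[a _ /setP/(_ a)]; rewrite !inE eqxx.
Qed.

Lemma prepart1_subproof :
  partition (set0 : {set {set 'I_N}}) (~: [set: 'I_N]).
Proof. by rewrite setCT partition_set0. Qed.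

Definition dowling0 : dowling :=
  \pi_dowling (@Prepart (set0, [set [set a] | a : 'I_N], [ffun=> 0])
                prepart0_subproof).

Definition dowling1 : dowling :=
  \pi_dowling (@Prepart (setT, set0, [ffun=> 0]) prepart1_subproof).

(* When k divides s, the residue of a label modulo k is well defined, and the
   condition below depends only on the class of the prepartition. *)
Definition balanced (d k : nat) (p : prepart) : bool :=
  [forall B in blocks p,
     (d %| #|B|)%N &&
     [forall j1 : 'I_k, forall j2 : 'I_k,
        #|[set a in B | (lab p a %% k)%N == j1]| ==
        #|[set a in B | (lab p a %% k)%N == j2]|]].

Definition dowling_sub (d k : nat) (J : {set 'I_N.+1}) : {set dowling} :=
  dowling0 |: [set x : dowling | [forall j in J, #|zero_block (repr x)| != j]
                                 & balanced d k (repr x)].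

Definition dowling_mu (d k : nat) (J : {set 'I_N.+1}) : int :=
  mobius (dowling_sub d k J) dowling0 dowling1.

End Dowling.

Arguments dowling0 N s : clear implicits.
Arguments dowling1 N s : clear implicits.
Arguments dowling_sub N s d k J : clear implicits.
Arguments dowling_mu N s d k J : clear implicits.

(* Formal power series with rational coefficients, as coefficient sequences. *)
Definition series := nat -> rat.

Definition series_from (m : nat) (f : series) : series :=
  fun n => if (m <= n)%N then f n else 0.

Definition series_opp (f : series) : series := fun n => - f n.

Definition series_mul (f g : series) : series :=
  fun n => \sum_(i < n.+1) f i * g (n - i)%N.

Definition series_expn (f : series) (k : nat) : series :=
  iter k (series_mul f) (fun n => (n == 0%N)%:R).

Definition gbinom (a : rat) (k : nat) : rat :=
  (\prod_(i < k) (a - i%:R)) / k`!%:R.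

(* For a series f with constant term 1, the power f ^ a is given by Newton's
   binomial series sum_k gbinom a k (f - 1)^k. Here [series_from 1 f] is f - 1,
   and its k-th power has no term of degree < k, so only the k <= n contribute
   to the coefficient of degree n. *)
Definition series_rpow (f : series) (a : rat) : series :=
  fun n => \sum_(k < n.+1) gbinom a k * series_expn (series_from 1 f) k n.

(* Main.v *)
Require Import Defs.
From mathcomp Require Import all_boot all_order all_algebra.

Set Implicit Arguments.
Unset Strict Implicit.
Unset Printing Implicit Defensive.

Import Order.TTheory GRing.Theory Num.Theory.
Local Open Scope ring_scope.
Local Open Scope quotient_scope.

(* Counting by colorings: a map f from [N] to {0} + Z/s x [m] has a kernel, and the classes of
   equal [m]-component, labelled by the Z/s-components, so it determines a flat of Q_N(s). A flat
   with l blocks arises from (s m)(s m - s)...(s m - s(l - 1)) maps, and the flat of f lies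
   above z exactly when f is compatible with z, which happens for (1 + s m)^(l(z)) maps. Hence
   sum_(w >= z) prod_(i < l(w)) (s a - s i) = (1 + s a)^(l(z)) for all natural a, so for all
   rational a; at a = -1/s the right-hand side is [z = 1], which inverts the Moebius function.
   Since the elements other than 0 of the subposet form an up-set of Q_N(s),
   - mu = sum_w prod_(i < l(w)) (s a - s i) at a = -1/s, over the flats w <> 0 of the subposet.
   For natural a = m this sum counts the maps with nonempty kernel all of whose color classes are
   balanced, which is (dn)! times a coefficient of the product of the exponential generating
   series of the nonempty sets and the m-th power of the series of balanced labelled sets;
   again both sides are polynomial in m. *)

(** * Power series *)

(** A nonzero polynomial has fewer roots than its size. This carries identities counted with m hues
    over to a = -1/s. *)
Lemma poly_eq_nat (p q : {poly rat}) :
  (forall m : nat, p.[m%:R] = q.[m%:R]) -> p = q.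
Proof.
move=> eq_pq; apply/eqP; rewrite -subr_eq0; apply/eqP.
apply: (@roots_geq_poly_eq0 _ _ [seq m%:R | m <- iota 0 (size (p - q)%R)]).
- by apply/allP => _ /mapP[m _ ->]; rewrite /root !hornerE eq_pq subrr.
- by rewrite map_inj_uniq ?iota_uniq //; apply: mulrIn; rewrite oner_eq0.
- by rewrite size_map size_iota.
Qed.

(** The substitution of b x for x respects products, hence powers. It absorbs the geometric factors
    of the final identity. *)
Lemma series_mul_scale (b : rat) (f g : series) (n : nat) :
  series_mul (fun i => f i * b ^+ i) (fun i => g i * b ^+ i) n =
  series_mul f g n * b ^+ n.
Proof.
rewrite /series_mul mulr_suml; apply: eq_bigr => i _.
have -> : b ^+ n = b ^+ i * b ^+ (n - i) by rewrite -exprD subnKC // -ltnS.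
by rewrite mulrACA.
Qed.

Lemma eq_series_mul (f f' g g' : series) :
  f =1 f' -> g =1 g' -> series_mul f g =1 series_mul f' g'.
Proof. by move=> ef eg n; apply: eq_bigr => i _; rewrite ef eg. Qed.

Lemma eq_series_expn (f g : series) (k : nat) :
  f =1 g -> series_expn f k =1 series_expn g k.
Proof.
by move=> efg; elim: k => //= k IHk; apply: eq_series_mul.
Qed.

Lemma series_expn_scale (b : rat) (f : series) (k n : nat) :
  series_expn (fun i => f i * b ^+ i) k n = series_expn f k n * b ^+ n.
Proof.
elim: k n => [|k IHk] n /=; first by case: n => [|n]; rewrite ?mul0r // mul1r.
rewrite -series_mul_scale; exact: eq_series_mul.
Qed.

Lemma series_rpow_scale (b a : rat) (f : series) (n : nat) :
  series_rpow (fun i => f i * b ^+ i) a n = series_rpow f a n * b ^+ n.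
Proof.
rewrite /series_rpow mulr_suml; apply: eq_bigr => k _.
rewrite -mulrA -series_expn_scale; congr (_ * _); apply: eq_series_expn => i.
by rewrite /series_from; case: ifP; rewrite ?mul0r.
Qed.

(** Only degrees up to n matter for coefficient n, so series can be traded for polynomials, where
    ring theory applies. *)
Lemma coef_mul_poly_series (f g : series) (n : nat) (p q : {poly rat}) :
  (forall i, (i <= n)%N -> p`_i = f i) -> (forall i, (i <= n)%N -> q`_i = g i) ->
  (p * q)`_n = series_mul f g n.
Proof.
move=> pf qg; rewrite coefM; apply: eq_bigr => i _.
by rewrite pf ?qg ?leq_subr // -ltnS.
Qed.

Lemma coef_exp_poly_series (f : series) (p : {poly rat}) (n k : nat) :
  (forall i, (i <= n)%N -> p`_i = f i) ->
  forall i, (i <= n)%N -> (p ^+ k)`_i = series_expn f k i.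
Proof.
move=> pf; elim: k => [|k IHk] i le_in /=; first by rewrite expr0 coef1.
by rewrite exprS; apply: coef_mul_poly_series => j le_ji;
  [apply: pf | apply: IHk]; apply: leq_trans le_ji le_in.
Qed.

Lemma series_expn_lt (f : series) (k n : nat) :
  f 0%N = 0 -> (n < k)%N -> series_expn f k n = 0.
Proof.
move=> f0; elim: k n => // k IHk n lt_nk.
rewrite /= /series_mul big1 // => -[[|i] /= lt_in] _; first by rewrite f0 mul0r.
by rewrite IHk ?mulr0 // ltn_subLR // addSn addnC; apply: leq_trans lt_nk _; rewrite ltnS leq_addr.
Qed.

Lemma gbinom_nat (m k : nat) : gbinom m%:R k = 'C(m, k)%:R.
Proof.
rewrite /gbinom; have k_neq0 : k`!%:R != 0 :> rat by rewrite pnatr_eq0 -lt0n fact_gt0.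
apply: (canLR (mulfK k_neq0)); rewrite -natrM bin_ffact.
elim: k {k_neq0} => [|k IHk]; first by rewrite big_ord0 ffactn0.
rewrite big_ord_recr /= IHk ffactnSr natrM.
have [le_km | lt_mk] := leqP k m; first by rewrite natrB.
by rewrite ffact_small // !mul0r.
Qed.

(** The binomial theorem for 1 + (f - 1), carried out on a polynomial truncation of f - 1. *)
Lemma series_rpow_nat (f : series) (m n : nat) :
  f 0%N = 1 -> series_rpow f m%:R n = series_expn f m n.
Proof.
move=> f0; pose p := \poly_(i < n.+1) series_from 1 f i.
have pE i : (i <= n)%N -> p`_i = series_from 1 f i.
  by move=> le_in; rewrite coef_poly ltnS le_in.
have p1E i : (i <= n)%N -> (p + 1)`_i = f i.
  by move=> le_in; rewrite coefD pE // coef1; case: i le_in => [|i] _;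
    rewrite /series_from /= ?f0 ?add0r ?addr0.
rewrite -(coef_exp_poly_series m p1E) // addrC exprDn coef_sum.
have E k : gbinom m%:R k * series_expn (series_from 1 f) k n =
    (1 ^+ (m - k) * p ^+ k *+ 'C(m, k))`_n.
  by rewrite gbinom_nat expr1n mul1r coefMn (coef_exp_poly_series k pE) // mulr_natl.
rewrite /series_rpow (eq_bigr _ (fun k _ => E (nat_of_ord k))).
pose G k := (1 ^+ (m - k) * p ^+ k *+ 'C(m, k))`_n.
rewrite -(big_mkord xpredT G) -(big_mkord xpredT G).
(* One sum stops at n, the other at m. Beyond m the binomial coefficient vanishes, beyond n the
   coefficient of (f - 1)^k does, so both sums reduce to k <= min(m, n). *)
have G0 k : (minn m n < k)%N -> G k = 0.
  rewrite gtn_min /G => /orP[lt_mk | lt_nk]; first by rewrite bin_small // mulr0n coef0.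
  by rewrite -E series_expn_lt ?mulr0.
suff tail l : (minn m n <= l)%N ->
    \sum_(0 <= k < l.+1) G k = \sum_(0 <= k < (minn m n).+1) G k.
  by rewrite !tail ?geq_minl ?geq_minr.
move=> le_l; rewrite (@big_cat_nat _ _ _ (minn m n).+1) //=.
rewrite (@big_nat_cond _ _ _ (minn m n).+1) (@big1 _ _ _ _ (index_iota (minn m n).+1 l.+1)) ?addr0 // => k.
by rewrite andbT => /andP[lt_k _]; apply: G0.
Qed.

(** Polynomial in the exponent, so that [poly_eq_nat] can be applied to powers of series. *)
Definition gbinom_poly (k : nat) : {poly rat} :=
  k`!%:R^-1 *: \prod_(i < k) ('X - i%:R%:P).

Lemma horner_gbinom_poly (k : nat) (a : rat) : (gbinom_poly k).[a] = gbinom a k.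
Proof.
rewrite /gbinom_poly hornerZ horner_prod mulrC; congr (_ * _).
by apply: eq_bigr => i _; rewrite !hornerE.
Qed.

Definition series_rpow_poly (f : series) (n : nat) : {poly rat} :=
  \sum_(k < n.+1) series_expn (series_from 1 f) k n *: gbinom_poly k.

Lemma horner_series_rpow_poly (f : series) (n : nat) (a : rat) :
  (series_rpow_poly f n).[a] = series_rpow f a n.
Proof.
rewrite /series_rpow_poly horner_sum; apply: eq_bigr => k _.
by rewrite hornerZ horner_gbinom_poly mulrC.
Qed.

(* Truncates [w], so that it is the exponential generating function only if [w] vanishes from [K] on. *)
Definition egf (K : nat) (w : nat -> rat) : {poly rat} :=
  \poly_(k < K) (w k / k`!%:R).

Lemma coef_egf (K : nat) (w : nat -> rat) (k : nat) :
  (forall k, (K <= k)%N -> w k = 0) -> (egf K w)`_k = w k / k`!%:R.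
Proof.
by move=> wK; rewrite coef_poly; case: ltnP => // le_Kk; rewrite wK ?mul0r.
Qed.

Lemma deriv_egf (K : nat) (w : nat -> rat) :
  (forall k, (K <= k)%N -> w k = 0) -> (egf K w)^`() = egf K (fun k => w k.+1).
Proof.
move=> wK; apply/polyP => k; rewrite coef_deriv !coef_egf //; last first.
  by move=> j le_Kj; apply/wK/leqW.
by rewrite factS natrM -[LHS]mulr_natr invfM mulrA mulrAC divfK // pnatr_eq0.
Qed.

Lemma deriv_prod (I : finType) (F : I -> {poly rat}) :
  (\prod_i F i)^`() = \sum_i (F i)^`() * \prod_(j | j != i) F j.
Proof.
suff gen (s : seq I) : uniq s -> (\prod_(i <- s) F i)^`() =
    \sum_(i <- s) (F i)^`() * \prod_(j <- s | j != i) F j.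
  by rewrite gen ?index_enum_uniq //.
elim: s => [|i s IHs] /=; first by rewrite !big_nil derivC.
case/andP=> iNs us; rewrite !big_cons derivM IHs // eqxx /=; congr (_ * _ + _).
  rewrite [RHS]big_seq_cond [LHS]big_seq; apply: eq_bigl => j.
  by case js: (j \in s) => //=; apply/esym/eqP => eji; rewrite -eji js in iNs.
rewrite mulr_sumr !big_seq; apply: eq_bigr => j js; rewrite big_cons.
have -> : i != j by apply/eqP => eij; rewrite eij js in iNs.
by rewrite mulrCA.
Qed.

(** * Sums over colorings weighted by class sizes *)

Section ColorClasses.

Variables (C D : finType) (rho : C -> D).

Definition class_size N (f : {ffun 'I_N -> C}) (c : D) : nat :=
  #|[set a | rho (f a) == c]|.

(** The product formula for exponential generating functions; a class of size k can be colored in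
    |rho^-1(c)|^k ways. By induction on N: removing the first point shifts the weight of its class
    by one, which is what the Leibniz rule does to the product. *)
Lemma sum_color_classes (N K : nat) (w : D -> nat -> rat) :
  (forall c k, (K <= k)%N -> w c k = 0) ->
  \sum_(f : {ffun 'I_N -> C}) \prod_c w c (class_size f c) =
  N`!%:R * (\prod_c egf K (fun k => #|[set x | rho x == c]|%:R ^+ k * w c k))`_N.
Proof.
elim: N w => [|N IHN] w wK.
  have f0 (f : {ffun 'I_0 -> C}) (c : D) : class_size f c = 0%N.
    by apply: eq_card0 => -[].
  rewrite (eq_bigr (fun=> \prod_c w c 0%N)); last first.
    by move=> f _; apply: eq_bigr => c _; rewrite f0.
  rewrite sumr_const card_ffun card_ord expn0 mulr1n fact0 mul1r.
  rewrite -horner_coef0 horner_prod; apply: eq_bigr => c _.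
  rewrite horner_coef0 coef_egf ?fact0 ?expr0 ?divr1 ?mul1r //.
  by move=> k le_Kk; rewrite wK ?mulr0.
pose h (u : C * {ffun 'I_N -> C}) : {ffun 'I_N.+1 -> C} :=
  [ffun i => if unlift ord0 i is Some j then u.2 j else u.1].
pose h' (f : {ffun 'I_N.+1 -> C}) := (f ord0, [ffun i => f (lift ord0 i)]).
have hK : cancel h h'.
  case=> c f; rewrite /h /h' /= !ffunE unlift_none; congr (_, _).
  by apply/ffunP => i; rewrite !ffunE liftK.
have h'K : cancel h' h.
  move=> f; apply/ffunP => i; rewrite ffunE /=.
  by case: unliftP => [j ->|->]; rewrite ?ffunE.
have hsize c f e : class_size (h (c, f)) e = ((rho c == e) + class_size f e)%N.
  rewrite /class_size -!sum1dep_card [LHS]big_mkcond big_ord_recl /=.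
  rewrite ffunE unlift_none /=; congr (_ + _)%N.
  rewrite [RHS]big_mkcond; apply: eq_bigr => i _.
  by rewrite !ffunE liftK.
rewrite (reindex h) /=; last by exists h' => u _; [apply: hK | apply: h'K].
rewrite -(pair_big xpredT xpredT (fun c f => \prod_e w e (class_size (h (c, f)) e))) /=.
(* The weights seen by the remaining points once the first one lies in class [c]. *)
pose v c e k := w e ((c == e) + k)%N.
have vK c e k : (K <= k)%N -> v c e k = 0.
  by move=> le_Kk; apply: wK; apply: leq_trans le_Kk (leq_addl _ _).
have step c : \sum_f \prod_e w e (class_size (h (c, f)) e) =
    N`!%:R * (\prod_e egf K (fun k => #|[set x | rho x == e]|%:R ^+ k * v (rho c) e k))`_N.
  rewrite -IHN; last by move=> ? ?; apply: vK.
  by apply: eq_bigr => f _; apply: eq_bigr => e _; rewrite hsize.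
rewrite (eq_bigr _ (fun c _ => step c)) -mulr_sumr.
rewrite factS mulnC natrM -mulrA; congr (_ * _).
rewrite mulr_natl -coef_deriv deriv_prod coef_sum.
(* All first colors of class [e] contribute equally; their number is the extra factor in
   |rho^-1(e)|^(k+1) after differentiation. *)
rewrite (partition_big rho xpredT) //=; apply: eq_bigr => e _.
rewrite (eq_bigr (fun=> (\prod_e' egf K
   (fun k => #|[set x | rho x == e']|%:R ^+ k * v e e' k))`_N)); last first.
  by move=> c /eqP ->.
rewrite sumr_const -cardsE -[LHS]mulr_natl -coefZ; congr (_`_N).
rewrite deriv_egf; last by move=> k le_Kk; rewrite wK ?mulr0.
have -> : egf K (fun k => #|[set x | rho x == e]|%:R ^+ k.+1 * w e k.+1) =
    #|[set x | rho x == e]|%:R *: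
      egf K (fun k => #|[set x | rho x == e]|%:R ^+ k * v e e k).
  apply/polyP => k; rewrite coefZ !coef_egf /v ?eqxx ?add1n ?exprS.
  - by rewrite !mulrA.
  - by move=> j le_Kj; rewrite wK ?mulr0 // add1n leqW.
  - by move=> j le_Kj; rewrite wK ?mulr0 // leqW.
rewrite -scalerAl (bigD1 e) //; f_equal; f_equal; apply: (congr1 ( *%R _)) => /=.
by apply: eq_bigr => e' ne'; rewrite /v eq_sym (negPf ne').
Qed.

End ColorClasses.

(** * Moebius functions *)

Lemma mobius_sum_le disp (T : finPOrderType disp) (A : {set T}) (x y : T) :
  x \in A -> y \in A -> \sum_(z in A | (z <= y)%O) mobius A x z = (x == y)%:R.
Proof.
move=> xA yA.
have mu0 z : ~~ (x <= z)%O -> mobius A x z = 0.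
  move=> Nxz; rewrite mobius_eq //; case: eqP => [exz|_]; first by rewrite exz lexx in Nxz.
  by case: ifP => // /ltW; rewrite (negPf Nxz).
rewrite (bigD1 y) ?yA //= mobius_eq //; case: eqP => [<-|neq] /=.
  rewrite big1 ?addr0 // => z /andP[/andP[_ le_zx] ne_zx]; apply: mu0.
  by apply: contra ne_zx => le_xz; rewrite eq_le le_zx.
have eqS : \sum_(z in A | (z <= y)%O && (z != y)) mobius A x z =
           \sum_(z in A | (x <= z < y)%O) mobius A x z.
  rewrite [LHS](bigID (fun z => x <= z)%O) /= [X in _ + X]big1 ?addr0.
    apply: eq_bigl => z; rewrite lt_neqAle.
    by case: (z \in A); case: (z <= y)%O; case: (x <= z)%O; case: (z == y).
  by move=> z /andP[_]; apply: mu0.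
rewrite (eq_bigl _ _ (fun z => esym (andbA _ _ _))) eqS; case: ifP => [_|Nlt].
  by rewrite addNr.
rewrite add0r big1 // => z /and3P[_ le_xz lt_zy].
by rewrite (le_lt_trans le_xz lt_zy) in Nlt.
Qed.

(** Evaluate the sum of mu(x, z) h(w) over z <= w in both orders, where h is g with a corrected
    value at x: summing over w first gives mu(x, y), summing over z first gives h(x). *)
Lemma mobius_dual disp (T : finPOrderType disp) (A : {set T}) (x y : T) (g : T -> rat) :
  x \in A -> y \in A -> (forall w, w \in A -> (x <= w)%O) ->
  (forall z, z \in A -> z != x ->
     \sum_(w in A | (z <= w)%O) g w = (z == y)%:R) ->
  x != y -> (mobius A x y)%:~R = - \sum_(w in A | w != x) g w.
Proof.
move=> xA yA x_min g_sum ne_xy.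
(* The value [c] makes h sum to 0 over all of A, which is the case z = x that the hypothesis on g
   leaves out. *)
pose c := - \sum_(w in A | w != x) g w; pose h w := if w == x then c else g w.
have h_sum z : z \in A -> \sum_(w in A | (z <= w)%O) h w = (z == y)%:R.
  move=> zA; have [-> | ne_zx] := eqVneq z x.
    rewrite (bigD1 x) /= ?xA ?lexx // {1}/h eqxx (negPf ne_xy) /c addrC.
    apply/eqP; rewrite subr_eq0; apply/eqP; apply: eq_big => w.
      by case wA: (w \in A); rewrite //= x_min.
    by rewrite /h => /andP[_ /negPf ->].
  rewrite -(g_sum _ zA ne_zx); apply: eq_bigr => w /andP[_ le_zw]; rewrite /h.
  case: eqP => // ewx; move: le_zw; rewrite ewx => le_zx.
  by move: ne_zx; rewrite eq_le le_zx x_min.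
have e1 : \sum_(z in A) \sum_(w in A | (z <= w)%O) (mobius A x z)%:~R * h w =
    (mobius A x y)%:~R.
  rewrite (eq_bigr (fun z => (mobius A x z)%:~R * (z == y)%:R)); last first.
    by move=> z zA; rewrite -mulr_sumr h_sum.
  rewrite (bigD1 y) //= eqxx mulr1 big1 ?addr0 // => z /andP[_ /negPf ->].
  by rewrite mulr0.
rewrite -e1 (exchange_big_dep (mem A)) /=; last by move=> ? ? _ /andP[].
rewrite (eq_bigr (fun w => (x == w)%:R * h w)); last first.
  move=> w wA; rewrite -mulr_suml; congr (_ * _).
  have := congr1 (fun i : int => i%:~R : rat) (mobius_sum_le xA wA).
  rewrite rmorph_sum rmorph_nat /= => <-.
  by apply: eq_bigl => z; rewrite wA.
rewrite (bigD1 x) //= eqxx mul1r /h eqxx big1 ?addr0 // => w /andP[_].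
by rewrite eq_sym => /negPf ->; rewrite mul0r.
Qed.

(** * Flats and colorings *)

Section Colorings.

Variables N s m : nat.

(* [Some (g, c)] is the element g of the c-th of m disjoint copies of Z/s, [None] the extra
   point 0; the number m of hues is a free parameter. *)
Definition color := option (zmod s * 'I_m).
Definition coloring := {ffun 'I_N -> color}.
Implicit Types (u : color) (f : coloring) (p q : prepart N s).

(** The action of Z/s on colors; its orbits are the hues, with [None] as the hue of the fixed
    point. *)
Definition shift (g : zmod s) u : color :=
  if u is Some (h, c) then Some (h + g, c) else None.
Definition hue u : option 'I_m := omap snd u.
(** The default 0 at [None] is harmless: labels on the zero block are ignored and [shift] fixes
    [None]. *)
Definition tone u : zmod s := if u is Some (g, _) then g else 0.

Lemma shift0 u : shift 0 u = u.
Proof. by case: u => [[g c]|] //=; rewrite addr0. Qed.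

Lemma shiftD g h u : shift h (shift g u) = shift (g + h) u.
Proof. by case: u => [[k c]|] //=; rewrite addrA. Qed.

Lemma hue_shift g u : hue (shift g u) = hue u.
Proof. by case: u => [[k c]|]. Qed.

Lemma hue_eq_None u : (hue u == None) = (u == None).
Proof. by case: u. Qed.

Lemma eq_hueP u v : hue u = hue v -> v = shift (tone v - tone u) u.
Proof.
by case: u v => [[g c]|] [[h e]|] //= [->]; rewrite addrC subrK.
Qed.

Definition kernel f : {set 'I_N} := [set a | f a == None].

Definition part_of f : prepart N s :=
  Prepart (prepart_val := (kernel f, preim_partition (hue \o f) (~: kernel f),
                           [ffun a => tone (f a)]))
          (preim_partitionP _ _).

Definition flat_of f : dowling N s := \pi_(dowling N s) (part_of f).

(** The equations of the subspace attached to a flat. Only label differences within a block occur,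
    so they depend on the class of p alone. *)
Definition compat p f : bool :=
  [forall a in zero_block p, f a == None] &&
  [forall B in blocks p, forall a in B, forall b in B,
     f b == shift (lab p b - lab p a) (f a)].

Lemma compatP p f :
  reflect ((forall a, a \in zero_block p -> f a = None) /\
           (forall B a b, B \in blocks p -> a \in B -> b \in B ->
              f b = shift (lab p b - lab p a) (f a)))
          (compat p f).
Proof.
apply: (iffP andP) => [[/forall_inP h0 /forall_inP h1]|[h0 h1]]; split.
- by move=> a /h0/eqP.
- by move=> B a b /h1/forall_inP h /h/forall_inP h' /h'/eqP.
- by apply/forall_inP => a /h0 ->.
- apply/forall_inP => B Bp; apply/forall_inP => a aB; apply/forall_inP => b bB.
  by rewrite -(h1 B).
Qed.

Lemma prepart_partition p : partition (blocks p) (~: zero_block p).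
Proof. exact: (valP p). Qed.

Lemma block_neq0 p B : B \in blocks p -> exists a, a \in B.
Proof.
by move=> Bp; apply/set0Pn; apply: contraNneq (_ : set0 \notin blocks p) => [<-|//];
  case/and3P: (prepart_partition p).
Qed.

Lemma block_sub p B a : B \in blocks p -> a \in B -> a \notin zero_block p.
Proof.
move=> Bp aB; have /and3P[/eqP cov _ _] := prepart_partition p.
by have : a \in cover (blocks p); [apply/bigcupP; exists B | rewrite cov inE].
Qed.

Lemma block_uniq p B B' a : B \in blocks p -> B' \in blocks p ->
  a \in B -> a \in B' -> B = B'.
Proof.
move=> Bp B'p aB aB'; have /and3P[_ tI _] := prepart_partition p.
by rewrite -(def_pblock tI Bp aB) (def_pblock tI B'p aB').
Qed.

Lemma pblock_block p a : a \notin zero_block p ->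
  (pblock (blocks p) a \in blocks p) && (a \in pblock (blocks p) a).
Proof.
move=> aI; have /and3P[/eqP cov _ _] := prepart_partition p.
have acov : a \in cover (blocks p) by rewrite cov inE.
by rewrite pblock_mem // mem_pblock.
Qed.

Lemma flat_eqP p q :
  reflect [/\ zero_block p = zero_block q, blocks p = blocks q &
             forall B, B \in blocks p -> exists g, forall a, a \in B -> lab q a = lab p a + g]
          (\pi_(dowling N s) p == \pi_(dowling N s) q).
Proof.
have -> : (\pi_(dowling N s) p == \pi_(dowling N s) q) = prepart_equiv p q.
  by apply/eqP/idP => [/eqmodP|/eqmodP].
apply: (iffP and3P) => [[/eqP h0 /eqP h1 /forall_inP h2]|[h0 h1 h2]]; split.
- exact: h0.
- exact: h1.
- by move=> B /h2/existsP[g /forall_inP hg]; exists g => a /hg/eqP.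
- by rewrite h0.
- by rewrite h1.
- apply/forall_inP => B /h2[g hg]; apply/existsP; exists g.
  by apply/forall_inP => a /hg ->.
Qed.

Lemma compat_flat p q f :
  \pi_(dowling N s) p = \pi_(dowling N s) q -> compat p f -> compat q f.
Proof.
case/eqP/flat_eqP=> e0 e1 el /compatP[h0 h1]; apply/compatP; rewrite -e0 -e1.
split=> // B a b Bp aB bB; have [g hg] := el B Bp.
by rewrite (h1 B a b Bp aB bB) !hg // opprD addrACA subrr addr0.
Qed.

Lemma mem_blocks_part_of f B a : B \in blocks (part_of f) -> a \in B ->
  forall b, (b \in B) = (hue (f b) == hue (f a)).
Proof.
case/imsetP=> c; rewrite inE => cI ->; rewrite inE => /andP[_ /eqP /= eca] b.
move: cI; rewrite !inE /= -!hue_eq_None eca [RHS]eq_sym.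
by move=> Na; case: (hue (f a) =P hue (f b)) => [<-|_]; rewrite ?Na ?andbF.
Qed.

Lemma compat_part_of f : compat (part_of f) f.
Proof.
apply/compatP; split=> [a|B a b BP aB bB]; first by rewrite inE => /eqP.
rewrite !ffunE; apply: eq_hueP; apply/eqP.
by rewrite -(mem_blocks_part_of BP bB).
Qed.

(** Merging only adds equations: f vanishes on [B], so the relations of p within [B] hold
    trivially. *)
Lemma compat_merge_zero p q f : merge_zero p q -> compat q f -> compat p f.
Proof.
case/exists_inP=> B Bp /and3P[/eqP eI /eqP eB /forall_inP el] /compatP[h0 h1].
apply/compatP; split=> [a aI|B' a b B'p aB' bB']; first by apply: h0; rewrite eI inE aI.
have [eBB | neBB] := eqVneq B' B.
  by rewrite !h0 // eI inE -eBB ?aB' ?bB' orbT.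
have B'q : B' \in blocks q by rewrite eB !inE neBB.
have lq c : c \in B' -> lab q c = lab p c.
  by move=> cB'; apply/eqP/el; rewrite inE (block_sub B'q).
by rewrite (h1 B' a b) // !lq.
Qed.

Lemma compat_merge_nonzero p q f : merge_nonzero p q -> compat q f -> compat p f.
Proof.
case/exists_inP=> B1 B1p /exists_inP[B2 B2p /existsP[g]].
case/and4P=> neB /eqP eI /eqP eB /forall_inP el /compatP[h0 h1].
apply/compatP; split=> [a aI|B a b Bp aB bB]; first by apply: h0; rewrite eI.
(* Each block of p lies in a block of q, and on it the two labellings differ by a constant, which
   cancels in differences. *)
have [C Cq BC] : exists2 C, C \in blocks q & B \subset C.
  have [-> | ne1] := eqVneq B B1; first by exists (B1 :|: B2); rewrite ?subsetUl // eB setU11.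
  have [-> | ne2] := eqVneq B B2; first by exists (B1 :|: B2); rewrite ?subsetUr // eB setU11.
  by exists B => //; rewrite eB !inE ne1 ne2 Bp !orbT.
rewrite (h1 C a b) ?(subsetP BC) //; congr (shift _ _).
have lq c : c \in B -> lab q c = if c \in B2 then lab p c + g else lab p c.
  by move=> cB; apply/eqP/el; rewrite inE eI (block_sub Bp).
rewrite !lq //; have [eBB | neBB] := eqVneq B B2.
  by rewrite -eBB aB bB opprD addrACA subrr addr0.
have NB2 c : c \in B -> c \in B2 = false.
  by move=> cB; apply/negP => cB2; rewrite (block_uniq Bp B2p cB cB2) eqxx in neBB.
by rewrite !NB2.
Qed.

Lemma le_compat p f : (\pi_(dowling N s) p <= flat_of f)%O -> compat p f.
Proof.
case/connectP=> w; elim: w p => [|y w IHw] p /=.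
  by move=> _ ew; apply: (@compat_flat (part_of f)) (compat_part_of f); rewrite -[RHS]ew.
case/andP=> /existsP[p' /existsP[q /and3P[/eqP epp' /eqP eqy mrg]]] wP ew.
apply: compat_flat epp' _; have cq : compat q f by apply: IHw; rewrite eqy.
by case/orP: mrg => mrg; [apply: compat_merge_zero cq | apply: compat_merge_nonzero cq].
Qed.

(** The hypotheses say that f is generic in the flat of p: it satisfies no equations beyond those of
    p, so its kernel and hue classes are the zero block and the blocks. *)
Lemma flat_of_eq p f : compat p f ->
  (forall B a, B \in blocks p -> a \in B -> f a != None) ->
  (forall B B' a b, B \in blocks p -> B' \in blocks p -> a \in B -> b \in B' ->
     hue (f a) = hue (f b) -> B = B') ->
  \pi_(dowling N s) p = flat_of f.
Proof.
move=> /compatP[h0 h1] hN hinj; apply/eqP/flat_eqP.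
have eI : zero_block p = kernel f.
  apply/setP => a; rewrite inE; apply/idP/eqP => [/h0 // | fa0].
  apply: contraTT isT => /pblock_block/andP[Bp aB].
  by have := hN _ _ Bp aB; rewrite fa0 eqxx.
split=> //.
  rewrite -[LHS](preim_partition_pblock (prepart_partition p)).
  rewrite /blocks /= -eI; apply: eq_in_imset => a; rewrite inE => aI.
  apply/setP => b; rewrite !inE; case bI: (b \in zero_block p) => //=.
  have /andP[Bap aB] := pblock_block aI.
  have /andP[Bbp bB] := pblock_block (negbT bI).
  apply/eqP/eqP => [eB | /(hinj _ _ a b Bap Bbp aB bB) //].
  by rewrite (h1 (pblock (blocks p) a) a b) ?hue_shift // eB.
(* The constant by which the two labellings differ on [B] is read off at any one point b. *)
move=> B Bp; have [b bB] := block_neq0 Bp; exists (tone (f b) - lab p b) => a aB.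
rewrite ffunE (h1 B b a) //; have := hN B b Bp bB.
by case: (f b) => [[g c]|] //= _; rewrite addrC addrA [RHS]addrAC -addrA.
Qed.

Lemma merge_zero_partition p B : B \in blocks p ->
  partition (blocks p :\ B) (~: (zero_block p :|: B)).
Proof. by move=> Bp; rewrite setCU -setDE partitionD1 ?prepart_partition. Qed.

Lemma merge_nonzero_partition p B1 B2 : B1 \in blocks p -> B2 \in blocks p -> B1 != B2 ->
  partition ((B1 :|: B2) |: (blocks p :\ B1 :\ B2)) (~: zero_block p).
Proof.
move=> B1p B2p ne12; have B2p1 : B2 \in blocks p :\ B1 by rewrite !inE eq_sym ne12.
have part := partitionD1 (partitionD1 (prepart_partition p) B1p) B2p1.
have -> : ~: zero_block p = (B1 :|: B2) :|: ((~: zero_block p) :\: B1 :\: B2).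
  apply/setP => a; rewrite !inE; case: (boolP (a \in B1)) => [/(block_sub B1p) -> //|_].
  by case: (boolP (a \in B2)) => [/(block_sub B2p) -> //|_].
apply: partitionU1 => //.
  by have [a aB1] := block_neq0 B1p; apply/set0Pn; exists a; rewrite inE aB1.
rewrite disjoint_sym disjoint_subset; apply/subsetP => a.
by rewrite !inE; case: (a \in B1); case: (a \in B2).
Qed.

Lemma cover_merge p q : merge_zero p q || merge_nonzero p q ->
  (\pi_(dowling N s) p <= \pi_(dowling N s) q)%O.
Proof.
move=> mrg; apply: connect1; apply/existsP; exists p; apply/existsP; exists q.
by rewrite !eqxx.
Qed.

(** Induction on the number of blocks. If f vanishes on a block, that block is merged into the zero
    block; if two blocks share a hue, they are merged; f stays compatible. Otherwise f is generic
    and [flat_of_eq] applies. *)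
Lemma compat_le p f : compat p f -> (\pi_(dowling N s) p <= flat_of f)%O.
Proof.
have [n] := ubnP #|blocks p|; elim: n p => // n IHn p; rewrite ltnS => le_pn cp.
have /compatP[h0 h1] := cp.
have [/exists_inP[B Bp /exists_inP[a aB /eqP fa0]] | allN] :=
    boolP [exists B in blocks p, exists a in B, f a == None].
  pose q := Prepart (prepart_val := (zero_block p :|: B, blocks p :\ B, lab p))
                    (merge_zero_partition Bp).
  apply: (@le_trans _ _ (\pi_(dowling N s) q)).
    apply: cover_merge; apply/orP; left; apply/exists_inP; exists B => //.
    by rewrite !eqxx; apply/forall_inP.
  apply: IHn.
    by apply: leq_trans le_pn; rewrite /blocks /= [leqRHS](cardsD1 B) Bp.
  apply/compatP; split=> [b|B' b c /setD1P[_]]; last exact: h1.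
  by rewrite inE => /orP[/h0 // | bB]; rewrite (h1 B a b) ?fa0.
have fN B a : B \in blocks p -> a \in B -> f a != None.
  move=> Bp aB; apply: contra allN => fa0.
  by apply/exists_inP; exists B => //; apply/exists_inP; exists a.
have [/exists_inP[B1 B1p /exists_inP[B2 B2p /andP[ne12]]] | distinct] :=
    boolP [exists B1 in blocks p, exists B2 in blocks p, (B1 != B2) &&
            [exists a in B1, exists b in B2, hue (f a) == hue (f b)]].
  case/exists_inP=> a aB1 /exists_inP[b bB2 /eqP eq_hue].
  (* Chosen so that the new labels of a and b differ exactly as the tones of f a and f b do. *)
  pose g := (lab p a - lab p b) + (tone (f b) - tone (f a)).
  pose l := [ffun c => if c \in B2 then lab p c + g else lab p c].
  pose q := Prepart (prepart_val := (zero_block p, (B1 :|: B2) |: (blocks p :\ B1 :\ B2), l))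
                    (merge_nonzero_partition B1p B2p ne12).
  have NB2 B c : B \in blocks p -> B != B2 -> c \in B -> c \in B2 = false.
    move=> Bp neB cB; apply/negP => cB2.
    by rewrite (block_uniq Bp B2p cB cB2) eqxx in neB.
  apply: (@le_trans _ _ (\pi_(dowling N s) q)).
    apply: cover_merge; apply/orP; right; apply/exists_inP; exists B1 => //.
    apply/exists_inP; exists B2 => //; apply/existsP; exists g.
    by rewrite ne12 !eqxx; apply/forall_inP => c _; rewrite /lab /= ffunE.
  apply: IHn.
    apply: leq_trans le_pn; rewrite /blocks /= [leqRHS](cardsD1 B1) B1p.
    rewrite [leqRHS]/= (cardsD1 B2 (_ :\ _)) !inE eq_sym ne12 B2p cardsU1.
    by rewrite ltnS leq_add2r leq_b1.
  have fE c : c \in B1 :|: B2 -> f c = shift (l c - lab p a) (f a).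
    rewrite inE ffunE; case: (boolP (c \in B2)) => [cB2 _ | _]; last first.
      by rewrite orbF => cB1; rewrite (h1 B1 a c).
    rewrite (h1 B2 b c) // (eq_hueP eq_hue) shiftD; congr (shift _ _).
    by rewrite /g addrC -!addrA; congr (_ + _); rewrite addrCA (addrC (lab p a)) -!addrA addNr addr0 addrCA.
  apply/compatP; split=> [|B c e]; first exact: h0.
  rewrite /blocks /= => /setU1P[->|].
    move=> cB eB; rewrite (fE e eB) (fE c cB) shiftD; congr (shift _ _).
    by rewrite [RHS]addrC subrKA.
  case/setD1P=> ne2 /setD1P[ne1 Bp] cB eB.
  by rewrite /lab /= !ffunE !(NB2 B) // (h1 B c e).
rewrite (@flat_of_eq p f) // => B B' a b Bp B'p aB bB' eq_hue.
apply: contraNeq distinct => neB.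
apply/exists_inP; exists B => //; apply/exists_inP; exists B' => //; rewrite neB.
by apply/exists_inP; exists a => //; apply/exists_inP; exists b => //; rewrite eq_hue.
Qed.

Lemma le_flat_of p f : (\pi_(dowling N s) p <= flat_of f)%O = compat p f.
Proof. by apply/idP/idP => [/le_compat|/compat_le]. Qed.

(** * Counting colorings through one color per block *)

(** [U B] is the color that a point of [B] with label 0 would receive. This parametrizes the
    colorings compatible with p. *)
Definition paint p (U : {ffun {B | B \in blocks p} -> color}) : coloring :=
  [ffun a => if insub (pblock (blocks p) a) is Some B then shift (lab p a) (U B)
             else None].

Lemma paintE p U (B : {B | B \in blocks p}) a : a \in val B ->
  paint U a = shift (lab p a) (U B).
Proof.
move=> aB; have /and3P[_ tI _] := prepart_partition p.
by rewrite ffunE (def_pblock tI (valP B) aB) valK.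
Qed.

Lemma paint_zero p U a : a \in zero_block p -> @paint p U a = None.
Proof.
(* On the zero block [pblock] takes its default, the empty set, which is not a block. *)
move=> aI; rewrite ffunE; case: insubP => // B _; rewrite /pblock.
case: pickP => [C /andP[Cp aC] | _ vB] /=; first by move: (block_sub Cp aC); rewrite aI.
by have [b] := block_neq0 (valP B); rewrite vB inE.
Qed.

Lemma compat_paint p U : compat p (@paint p U).
Proof.
apply/compatP; split=> [a|B a b Bp aB bB]; first exact: paint_zero.
rewrite (@paintE p U (exist _ B Bp) a) // (@paintE p U (exist _ B Bp) b) //.
by rewrite shiftD addrC subrK.
Qed.

Lemma paint_inj p : injective (@paint p).
Proof.
move=> U V eUV; apply/ffunP => B; have [a aB] := block_neq0 (valP B).
have /ffunP/(_ a) := eUV; rewrite !(paintE _ aB).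
by move/(congr1 (shift (- lab p a))); rewrite !shiftD subrr !shift0.
Qed.

Lemma compat_paintP p f : compat p f -> exists U, f = @paint p U.
Proof.
case/compatP=> h0 h1.
exists [ffun B : {B | B \in blocks p} =>
  if [pick a in val B] is Some a then shift (- lab p a) (f a) else None].
apply/ffunP => b; have [bI | /pblock_block/andP[Bp bB]] := boolP (b \in zero_block p).
  by rewrite paint_zero ?h0.
rewrite (@paintE p _ (exist (fun B => B \in blocks p) _ Bp)) // ffunE /=.
case: pickP => [a aB | /(_ b)]; last by rewrite bB.
by rewrite (h1 _ a b Bp) // shiftD addrC.
Qed.

Lemma card_compat p : #|[set f | compat p f]| = (#|{: color}| ^ #|blocks p|)%N.
Proof.
have -> : [set f | compat p f] = (@paint p) @: setT.
  apply/setP => f; rewrite inE; apply/idP/imsetP => [/compat_paintP[U ->]|[U _ ->]].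
    by exists U.
  exact: compat_paint.
by rewrite card_imset ?cardsT ?card_ffun ?card_sig; [|exact: paint_inj].
Qed.

Lemma flat_of_paint p U : (flat_of (@paint p U) == \pi_(dowling N s) p) =
  [forall B, U B != None] && injectiveb (hue \o U).
Proof.
apply/idP/idP => [|/andP[/forallP UN /injectiveP Uinj]]; last first.
  rewrite eq_sym; apply/eqP/flat_of_eq; first exact: compat_paint.
    move=> B a Bp aB; rewrite (@paintE p U (exist _ B Bp)) //.
    by rewrite -hue_eq_None hue_shift hue_eq_None.
  move=> B B' a b Bp B'p aB bB'; rewrite (@paintE p U (exist _ B Bp)) //.
  by rewrite (@paintE p U (exist _ B' B'p)) // !hue_shift => /Uinj[].
case/flat_eqP=> eI eB _; have UN (B : {B | B \in blocks p}) : U B != None.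
  have [a aB] := block_neq0 (valP B); have := block_sub (valP B) aB.
  by rewrite -eI inE (paintE _ aB) -!hue_eq_None hue_shift.
apply/andP; split; first exact/forallP.
apply/injectiveP => B B' /= eq_hue.
have [a aB] := block_neq0 (valP B); have [b bB'] := block_neq0 (valP B').
have Bpart : val B \in blocks (part_of (paint U)) by rewrite eB (valP B).
apply/val_inj/(block_uniq (valP B) (valP B') _ bB').
by rewrite (mem_blocks_part_of Bpart aB) !(paintE _ aB) !(paintE _ bB') !hue_shift eq_hue.
Qed.

(** The tones are arbitrary and the hues form an injection into 'I_m. *)
Lemma card_rainbow (D : finType) :
  #|[set U : {ffun D -> color} | [forall x, U x != None] && injectiveb (hue \o U)]| =
  (#|zmod s| ^ #|D| * m ^_ #|D|)%N.
Proof.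
pose mix (u : {ffun D -> zmod s} * {ffun D -> 'I_m}) : {ffun D -> color} :=
  [ffun x => Some (u.1 x, u.2 x)].
have mix_inj : injective mix.
  move=> [g c] [h e] /ffunP eq_mix.
  by congr (_, _); apply/ffunP => x; have := eq_mix x; rewrite !ffunE => -[].
have -> : [set U : {ffun D -> color} | [forall x, U x != None] && injectiveb (hue \o U)] =
    mix @: setX setT [set c : {ffun D -> 'I_m} | injectiveb c].
  apply/setP => U; rewrite inE; apply/andP/imsetP => [[/forallP UN /injectiveP Uinj]|].
    have /fin_all_exists[g gP] : forall x, exists u : zmod s * 'I_m, U x = Some u.
      by move=> x; case: (U x) (UN x) => // u _; exists u.
    exists ([ffun x => (g x).1], [ffun x => (g x).2]).
      rewrite !inE /=; apply/injectiveP => x y; rewrite !ffunE => eq_c.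
      by apply: Uinj; rewrite /= !gP /= eq_c.
    by apply/ffunP => x; rewrite !ffunE gP; case: (g x).
  case=> -[g c]; rewrite !inE /= => /injectiveP c_inj ->; split.
    by apply/forallP => x; rewrite ffunE.
  by apply/injectiveP => x y; rewrite /= !ffunE => -[/c_inj].
by rewrite card_imset // cardsX cardsT card_ffun card_inj_ffuns (card_ord m).
Qed.

Lemma card_flat_of (w : dowling N s) :
  #|[set f | flat_of f == w]| =
  (#|zmod s| ^ #|blocks (repr w)| * m ^_ #|blocks (repr w)|)%N.
Proof.
set p := repr w; have wE : \pi_(dowling N s) p = w by rewrite /p reprK.
have -> : [set f | flat_of f == w] =
    (@paint p) @: [set U : {ffun {B | B \in blocks p} -> color} |
                     [forall B, U B != None] && injectiveb (hue \o U)].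
  apply/setP => f; rewrite inE -wE; apply/idP/imsetP => [/eqP fw | [U UP ->]].
    have /compat_paintP[U fU] : compat p f by rewrite -le_flat_of -fw.
    by exists U => //; rewrite inE -flat_of_paint -fU fw.
  by rewrite flat_of_paint; rewrite inE in UP.
by rewrite card_imset ?card_rainbow ?card_sig //; apply: paint_inj.
Qed.

Lemma sum_card_flat_of (P : pred (dowling N s)) :
  #|[set f | P (flat_of f)]| =
  (\sum_(w | P w) #|zmod s| ^ #|blocks (repr w)| * m ^_ #|blocks (repr w)|)%N.
Proof.
rewrite -sum1dep_card (partition_big flat_of P) //=; apply: eq_bigr => w Pw.
rewrite -card_flat_of -sum1dep_card; apply: eq_bigl => f.
by case: eqP => [->|]; rewrite ?Pw ?andbF.
Qed.

End Colorings.

(** * The subposet of balanced flats *)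

(* This is [prod_(i < l) s (a - i)]: for natural [a], the number of colorings with [a] hues
   that induce a given flat with [l] blocks. *)
Definition weight (s l : nat) (a : rat) : rat := (s ^ l * l`!)%:R * gbinom a l.

Definition weight_poly (s l : nat) : {poly rat} := (s ^ l * l`!)%:R *: gbinom_poly l.

Lemma horner_weight_poly (s l : nat) (a : rat) : (weight_poly s l).[a] = weight s l a.
Proof. by rewrite hornerZ horner_gbinom_poly. Qed.

Lemma weight_nat (s l m : nat) : weight s l m%:R = (s ^ l * m ^_ l)%:R.
Proof. by rewrite /weight gbinom_nat -natrM -mulnA [(l`! * _)%N]mulnC bin_ffact. Qed.

Lemma blocks_repr N s (p : prepart N s) : blocks (repr (\pi_(dowling N s) p)) = blocks p.
Proof.
suff /eqP/flat_eqP[_ -> _] : \pi_(dowling N s) (repr (\pi_(dowling N s) p)) =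
    \pi_(dowling N s) p by [].
by rewrite reprK.
Qed.

Section Balanced.

Variables N s d : nat.
Hypotheses (s_gt0 : (0 < s)%N) (d_gt0 : (0 < d)%N) (d_dvd_s : (d %| s)%N).
Implicit Types (p q : prepart N s) (B : {set 'I_N}) (w z : dowling N s).

Let s_pred : s.-1.+1 = s. Proof. exact: prednK. Qed.

Lemma card_zmod : #|zmod s| = s.
Proof. by rewrite card_ord s_pred. Qed.

(** For a = m both sides count the colorings compatible with z: by the flat they induce, or by a
    choice among 1 + s m colors for each block of z. *)
Lemma sum_weight_ge z (a : rat) :
  \sum_(w | (z <= w)%O) weight s #|blocks (repr w)| a = (1 + s%:R * a) ^+ #|blocks (repr z)|.
Proof.
pose p := \sum_(w | (z <= w)%O) weight_poly s #|blocks (repr w)|.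
have pE b : p.[b] = \sum_(w | (z <= w)%O) weight s #|blocks (repr w)| b.
  by rewrite /p horner_sum; apply: eq_bigr => w _; rewrite horner_weight_poly.
rewrite -pE; suff -> : p = (1 + s%:R *: 'X) ^+ #|blocks (repr z)| by rewrite !hornerE.
apply: poly_eq_nat => m; rewrite pE.
rewrite (eq_bigr (fun w => (#|zmod s| ^ #|blocks (repr w)| * m ^_ #|blocks (repr w)|)%:R)).
  rewrite -natr_sum -(sum_card_flat_of m (fun w => (z <= w)%O)).
  rewrite (eq_card (B := [set f : coloring N s m | compat (repr z) f])); last first.
    by move=> f; rewrite !inE -le_flat_of reprK.
  rewrite card_compat card_option card_prod card_zmod card_ord.
  by rewrite !hornerE natrX -addn1 natrD natrM addrC.
by move=> w _; rewrite weight_nat card_zmod.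
Qed.

(** The balance condition on one block, stated through the common count [k], which adds up when
    blocks are merged. *)
Definition uniform B (l : {ffun 'I_N -> zmod s}) : Prop :=
  exists k, forall j : 'I_d, #|[set a in B | (l a %% d)%N == j]| = k.

Lemma uniform_card B l k :
  (forall j : 'I_d, #|[set a in B | (l a %% d)%N == j]| = k) -> #|B| = (d * k)%N.
Proof.
move=> Bk; rewrite -sum1_card.
rewrite (partition_big (fun a => Ordinal (ltn_pmod (l a) d_gt0)) xpredT) //=.
rewrite (eq_bigr (fun=> k)) ?sum_nat_const ?card_ord // => j _.
by rewrite sum1dep_card -(Bk j); apply: eq_card => a; rewrite !inE.
Qed.

Lemma balancedP p :
  reflect (forall B, B \in blocks p -> uniform B (lab p)) (balanced d d p).
Proof.
apply: (iffP forall_inP) => bal B Bp.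
  have /andP[_ /forallP eq_k] := bal B Bp.
  exists #|[set a in B | (lab p a %% d)%N == Ordinal d_gt0]| => j.
  by have /forallP/(_ (Ordinal d_gt0))/eqP := eq_k j.
have [k Bk] := bal B Bp; rewrite (uniform_card Bk) dvdn_mulr //=.
by apply/forallP => i; apply/forallP => j; rewrite !Bk.
Qed.

(** Adding g permutes the residues modulo d cyclically; since d divides s, the reduction modulo s
    does not disturb them. *)
Lemma uniform_shift B (l l' : {ffun 'I_N -> zmod s}) (g : zmod s) :
  (forall a, a \in B -> l' a = l a + g) -> uniform B l -> uniform B l'.
Proof.
move=> l'E [k Bk]; exists k => j.
(* The residue j - g modulo d, written so that truncated subtraction is exact. *)
rewrite -(Bk (Ordinal (ltn_pmod (j + (d - g %% d)) d_gt0))).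
apply: eq_card => a; rewrite !inE; case aB: (a \in B) => //=; rewrite l'E //.
have -> : (l a + g : zmod s) = ((l a + g) %% s)%N :> nat by congr modn.
rewrite modn_dvdm //= -(eqn_modDr (g %% d) (l a)) modnDmr -addnA subnK.
  by rewrite modnDr (modn_small (ltn_ord j)).
by rewrite ltnW ?ltn_pmod.
Qed.

Lemma uniformU B1 B2 l : [disjoint B1 & B2] ->
  uniform B1 l -> uniform B2 l -> uniform (B1 :|: B2) l.
Proof.
move=> dis [k1 B1k] [k2 B2k]; exists (k1 + k2)%N => j.
rewrite -(B1k j) -(B2k j) -cardsUI [X in (_ + X)%N](eq_card0 (A := _ :&: _)) ?addn0.
  by apply: eq_card => a; rewrite !inE -andb_orl.
move=> a; rewrite !inE; case aB1: (a \in B1) => //=.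
by rewrite (disjointFr dis aB1) andbF.
Qed.

(** The condition that cuts out the subposet for J = {0}, apart from its minimum. *)
Definition admissible p := (zero_block p != set0) && balanced d d p.

Lemma admissible_flat p q : \pi_(dowling N s) p = \pi_(dowling N s) q -> admissible p -> admissible q.
Proof.
case/eqP/flat_eqP=> e0 e1 el /andP[n0 /balancedP bal].
rewrite /admissible -e0 n0; apply/balancedP => B; rewrite -e1 => Bp.
by have [g gP] := el B Bp; apply: uniform_shift gP (bal B Bp).
Qed.

Lemma admissible_repr p : admissible (repr (\pi_(dowling N s) p)) = admissible p.
Proof. by apply/idP/idP; apply: admissible_flat; rewrite reprK. Qed.

Lemma admissible_merge_zero p q : merge_zero p q -> admissible p -> admissible q.
Proof.
case/exists_inP=> B Bp /and3P[/eqP eI /eqP eB /forall_inP el] /andP[n0 /balancedP bal].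
apply/andP; split.
  by rewrite eI; apply: contra n0; rewrite setU_eq0 => /andP[].
apply/balancedP => C Cq; have Cp : C \in blocks p by move: Cq; rewrite eB => /setD1P[].
apply: (@uniform_shift C (lab p) _ 0) (bal C Cp) => a aC.
by rewrite addr0; apply/eqP/el; rewrite inE (block_sub Cq aC).
Qed.

Lemma admissible_merge_nonzero p q : merge_nonzero p q -> admissible p -> admissible q.
Proof.
case/exists_inP=> B1 B1p /exists_inP[B2 B2p /existsP[g]].
case/and4P=> neB /eqP eI /eqP eB /forall_inP el /andP[n0 /balancedP bal].
rewrite /admissible eI n0; apply/balancedP => C Cq.
have lq B a : B \in blocks p -> a \in B -> lab q a = if a \in B2 then lab p a + g else lab p a.
  by move=> Bp aB; apply/eqP/el; rewrite inE eI (block_sub Bp).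
have uni2 : uniform B2 (lab q).
  by apply: (@uniform_shift B2 (lab p) _ g) (bal B2 B2p) => a aB; rewrite (lq B2) ?aB.
have uni B : B \in blocks p -> B != B2 -> uniform B (lab q).
  move=> Bp neB2; apply: (@uniform_shift B (lab p) _ 0) (bal B Bp) => a aB.
  rewrite addr0 (lq B) //; case: ifP => // aB2.
  by rewrite (block_uniq Bp B2p aB aB2) eqxx in neB2.
move: Cq; rewrite eB => /setU1P[->|/setD1P[ne2 /setD1P[_ Cp]]]; last exact: uni.
apply: uniformU => //; last exact: uni.
rewrite disjoint_subset; apply/subsetP => a aB1; rewrite !inE.
by apply/negP => aB2; rewrite (block_uniq B1p B2p aB1 aB2) eqxx in neB.
Qed.

(** Merges enlarge the zero block and keep blocks uniform. Hence sums over the part of the subposet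
    above z are sums over the whole Dowling lattice, where [sum_weight_ge] applies. *)
Lemma admissible_le z w : (z <= w)%O -> admissible (repr z) -> admissible (repr w).
Proof.
case/connectP=> c; elim: c z => [|y c IHc] z /=; first by move=> _ ->.
case/andP=> /existsP[p /existsP[q /and3P[/eqP pz /eqP qy mrg]]] yc wc gz.
apply: IHc yc wc _; rewrite -qy admissible_repr.
have gp : admissible p by rewrite -admissible_repr pz.
by case/orP: mrg => mrg; [apply: admissible_merge_zero gp | apply: admissible_merge_nonzero gp].
Qed.

Lemma in_dowling_sub w : (0 < N)%N ->
  (w \in dowling_sub N s d d [set ord0]) && (w != dowling0 N s) = admissible (repr w).
Proof.
move=> N_gt0.
have kw : [forall j in [set (ord0 : 'I_N.+1)], #|zero_block (repr w)| != j] =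
    (zero_block (repr w) != set0).
  rewrite -cards_eq0; apply/forall_inP/idP => [/(_ ord0 (set11 _)) // | h j].
  by rewrite inE => /eqP ->.
rewrite 3!inE kw -/(admissible _); case: (w =P dowling0 N s) => [->|_]; last by rewrite andbT.
by rewrite admissible_repr /admissible /zero_block /= eqxx.
Qed.

End Balanced.

(** * The Moebius number as a weighted sum over admissible flats *)

Section MobiusNumber.

Variables N s d : nat.
Hypotheses (s_gt0 : (0 < s)%N) (d_gt0 : (0 < d)%N) (d_dvd_s : (d %| s)%N).
Implicit Types (p q : prepart N s) (B : {set 'I_N}) (w z : dowling N s).

(** With as many hues as blocks some coloring induces w, and every coloring is compatible with the
    partition into singletons. *)
Lemma dowling0_le w : (dowling0 N s <= w)%O.
Proof.
have : (0 < #|[set f : coloring N s #|blocks (repr w)| | flat_of f == w]|)%N.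
  by rewrite card_flat_of ffactnn card_zmod // muln_gt0 expn_gt0 s_gt0 fact_gt0.
case/card_gt0P=> f; rewrite inE => /eqP <-; rewrite le_flat_of.
apply/compatP; split=> [a|B a b]; first by rewrite inE.
by case/imsetP=> c _ -> /set1P -> /set1P ->; rewrite subrr shift0.
Qed.

Lemma blocks_eq0 z : (#|blocks (repr z)| == 0%N) = (z == dowling1 N s).
Proof.
apply/idP/eqP => [|->]; last by rewrite blocks_repr cards0.
rewrite cards_eq0 => /eqP z0; apply/eqP; rewrite -[z]reprK; apply/flat_eqP.
have /and3P[/eqP cov _ _] := prepart_partition (repr z).
split; rewrite ?z0 //; last by move=> B; rewrite inE.
by rewrite /zero_block /= -[LHS]setCK -cov z0 /cover big_set0 setC0.
Qed.

Lemma dowling_muE : (0 < N)%N ->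
  (dowling_mu N s d d [set ord0])%:~R =
  - \sum_(w : dowling N s | admissible d (repr w)) weight s #|blocks (repr w)| (- s%:R^-1).
Proof.
move=> N_gt0; have subP w := in_dowling_sub s_gt0 d_gt0 d_dvd_s w N_gt0.
have good1 : admissible d (repr (dowling1 N s)).
  rewrite admissible_repr // /admissible /zero_block /=; apply/andP; split; last first.
    by apply/balancedP => // B; rewrite inE.
  by apply/set0Pn; exists (Ordinal N_gt0); rewrite inE.
have /andP[in1 ne10] : (dowling1 N s \in dowling_sub N s d d [set ord0]) &&
    (dowling1 N s != dowling0 N s) by rewrite subP.
have g_sum z : z \in dowling_sub N s d d [set ord0] -> z != dowling0 N s ->
    \sum_(w in dowling_sub N s d d [set ord0] | (z <= w)%O)
      weight s #|blocks (repr w)| (- s%:R^-1) = (z == dowling1 N s)%:R.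
  move=> zA zN0; have gz : admissible d (repr z) by rewrite -subP zA.
  rewrite (eq_bigl (fun w => (z <= w)%O)) => [|w]; last first.
    case le_zw: (z <= w)%O; rewrite ?andbF // andbT.
    by have := admissible_le s_gt0 d_gt0 d_dvd_s le_zw gz; rewrite -subP => /andP[].
  (* At a = -1/s the base 1 + s a is 0, and its power is 1 exactly when z has no nonzero block, that
     is, when z is the maximum. *)
  rewrite sum_weight_ge // mulrN divff ?subrr ?pnatr_eq0 -?lt0n //.
  by rewrite expr0n blocks_eq0.
have in0 : dowling0 N s \in dowling_sub N s d d [set ord0] by rewrite /dowling_sub setU11.
have ne01 : dowling0 N s != dowling1 N s by rewrite eq_sym.
rewrite /dowling_mu; have -> := mobius_dual in0 in1 (fun w _ => dowling0_le w) g_sum ne01.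
by congr (- _); apply: eq_bigl => w; rewrite subP.
Qed.

Variable m : nat.

(** Records the hue and the tone modulo d, which is all that admissibility of a coloring depends
    on. *)
Definition residue (u : color s m) : option ('I_m * 'I_d) :=
  if u is Some (g, c) then Some (c, Ordinal (ltn_pmod g d_gt0)) else None.

Lemma card_residue_None : #|[set u | residue u == None]| = 1%N.
Proof.
by rewrite -(cards1 (None : color s m)); apply: eq_card => -[[g c]|]; rewrite !inE.
Qed.

(** The tones congruent to j are k d + j for k < s / d. *)
Lemma card_residue_Some c j : #|[set u | residue u == Some (c, j)]| = (s %/ d)%N.
Proof.
have lt_s (k : 'I_(s %/ d)) : (k * d + j < s.-1.+1)%N.
  rewrite prednK //; apply: (@leq_trans (k.+1 * d)).
    by rewrite mulSn addnC ltn_add2r.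
  by rewrite -leq_divRL.
pose h (k : 'I_(s %/ d)) : color s m := Some (Ordinal (lt_s k) : zmod s, c).
have h_inj : injective h.
  by move=> k l [/addIn/eqP]; rewrite eqn_pmul2r // => /eqP/val_inj.
rewrite -[RHS]card_ord -cardsT -(card_imset _ h_inj); apply: eq_card => -[[g e]|]; last first.
  by rewrite inE; apply/esym/imsetP => -[].
rewrite inE; apply/eqP/imsetP => [[-> gj]|[k _ [-> ->]]]; last first.
  by congr (Some (_, _)); apply: val_inj; rewrite /= modnMDl modn_small.
have lt_g : (g %/ d < s %/ d)%N by rewrite ltn_divLR // divnK // -[X in (_ < X)%N]prednK.
exists (Ordinal lt_g) => //; congr (Some (_, _)); apply: val_inj.
by rewrite /= -gj /= -divn_eq.
Qed.

Lemma class_size_None (f : coloring N s m) : class_size residue f None = #|kernel f|.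
Proof. by apply: eq_card => a; rewrite !inE; case: (f a) => [[]|]. Qed.

Lemma residue_block (f : coloring N s m) B a c j : B \in blocks (part_of f) -> a \in B ->
  hue (f a) = Some c ->
  #|[set b in B | (lab (part_of f) b %% d)%N == nat_of_ord j]| = class_size residue f (Some (c, j)).
Proof.
move=> BP aB fac; apply: eq_card => b.
rewrite !inE (mem_blocks_part_of BP aB) fac ffunE.
by case: (f b) => [[g e]|].
Qed.

Lemma admissible_part_of (f : coloring N s m) :
  reflect (kernel f != set0 /\
           forall c, exists k, forall j, class_size residue f (Some (c, j)) = k)
          (admissible d (part_of f)).
Proof.
apply: (iffP andP) => -[n0 bal]; split=> //.
  (* A hue that f does not use corresponds to no block; its residue classes all have size 0. *)
  move=> c; have [a fac | fN] := pickP (fun a => hue (f a) == Some c); last first.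
    exists 0%N => j; apply: eq_card0 => a; rewrite !inE; move: (fN a).
    by case: (f a) => [[g e]|] //= Nec; apply: contraFF Nec => /eqP[-> _].
  have aP : a \notin zero_block (part_of f).
    by rewrite inE -hue_eq_None (eqP fac).
  have /andP[BP aB] := pblock_block aP.
  have /(balancedP d_gt0)/(_ _ BP)[k Bk] := bal.
  by exists k => j; rewrite -(Bk j) (residue_block _ BP aB (eqP fac)).
apply/balancedP => // B BP; have [a aB] := block_neq0 BP.
have := block_sub BP aB; rewrite inE -hue_eq_None; case fac: (hue (f a)) => [c|] // _.
by have [k ck] := bal c; exists k => j; rewrite (residue_block _ BP aB fac).
Qed.

End MobiusNumber.

(** * Counting balanced colorings *)

Lemma prod_option (R : comNzRingType) (I : finType) (F : option I -> R) :
  \prod_x F x = F None * \prod_i F (Some i).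
Proof.
rewrite (bigD1 None) //=; congr (_ * _).
rewrite (reindex_omap Some id) => [|[]] //=.
by apply: eq_bigl => i; rewrite eqxx.
Qed.

(** Only k = F x0 can contribute. This turns the existence of a common value into a sum of
    products. *)
Lemma sum_prod_eq (D : finType) (x0 : D) (n : nat) (F : D -> nat) :
  (F x0 <= n)%N ->
  \sum_(k < n.+1) \prod_x (F x == k)%:R = [forall x, F x == F x0]%:R :> rat.
Proof.
move=> le_n; rewrite (bigD1 (Ordinal (le_n : F x0 < n.+1)%N)) //= [X in _ + X]big1 ?addr0.
  case: forallP => [h | Nh]; first by rewrite big1 // => x _; rewrite h.
  apply/eqP; rewrite prodf_seq_eq0; apply: contra_notT Nh => /hasPn h x.
  by have := h x (mem_index_enum x); rewrite /= pnatr_eq0 eqb0 negbK.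
move=> k nek; rewrite (bigD1 x0) //= (_ : (F x0 == k) = false) ?mul0r //.
by apply: contraNF nek => /eqP eq_k; apply/eqP/val_inj.
Qed.

Section Count.

Variables d r n m : nat.
Hypotheses (d_gt0 : (0 < d)%N) (r_gt0 : (0 < r)%N).

Let s := (d * r)%N.
Let N := (d * n)%N.
Let rho := @residue s d d_gt0 m.

(** Once the common size [k c] of the residue classes of each hue is fixed, admissibility factors
    over the classes. The bound t <= N gives the vanishing that the truncation in [egf] requires. *)
Definition size_weight (k : {ffun 'I_m -> 'I_n.+1}) (x : option ('I_m * 'I_d)) (t : nat) : rat :=
  if x is Some (c, _) then (t == k c)%:R else [&& 0 < t, t <= N & d %| t]%N%:R.

Lemma class_size_sum (f : coloring N s m) :
  N = (class_size rho f None + \sum_c \sum_j class_size rho f (Some (c, j)))%N.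
Proof.
rewrite pair_bigA /= -[LHS]card_ord -sum1_card.
rewrite (partition_big (fun a => rho (f a)) xpredT) //= (bigD1 None) //=; congr (_ + _)%N.
  by rewrite sum1dep_card.
rewrite (reindex_omap Some id) => [|[]] //=.
by apply: eq_big => [i|[c j] _]; rewrite ?eqxx // sum1dep_card.
Qed.

Lemma admissible_size_weight (f : coloring N s m) :
  (admissible d (part_of f))%:R = \sum_k \prod_x size_weight k x (class_size rho f x).
Proof.
pose z : 'I_d := Ordinal d_gt0; pose F c j := class_size rho f (Some (c, j)).
have leN : (class_size rho f None <= N)%N by rewrite [leqRHS](class_size_sum f) leq_addr.
rewrite (eq_bigr (fun k : {ffun 'I_m -> 'I_n.+1} =>
    [&& 0 < class_size rho f None, class_size rho f None <= N
      & d %| class_size rho f None]%N%:R * \prod_c \prod_j (F c j == k c)%:R)); last first.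
  by move=> k _; rewrite prod_option pair_bigA /=; congr (_ * _); apply: eq_bigr => -[].
(* The kernel factor does not depend on [k], and the rest becomes a product over hues of sums over a
   single common size. *)
rewrite -mulr_sumr -(bigA_distr_bigA (fun c (k : 'I_n.+1) => \prod_j (F c j == k)%:R)) /=.
rewrite leN /=.
have [/admissible_part_of[n0 bal] | Ngood] := boolP (admissible d (part_of f)).
  have FE c j : F c j = F c z by have [k ck] := bal c; rewrite /F !ck.
  have rowE c : (\sum_j F c j = d * F c z)%N.
    by rewrite (eq_bigr (fun=> F c z)) ?sum_nat_const ?card_ord // => j _.
  (* The hue c colors d * F c z of the d n points, so its common size is within the range of [k]. *)
  have len c : (F c z <= n)%N.
    rewrite -(leq_pmul2l d_gt0) -rowE -/N [leqRHS](class_size_sum f).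
    by rewrite (bigD1 c) //= addnCA leq_addr.
  rewrite big1 => [|c _]; last first.
    by rewrite (sum_prod_eq (x0 := z)) //; case: forallP => // -[] j; rewrite FE.
  rewrite -card_gt0 -(class_size_None d_gt0) in n0; rewrite n0 mulr1 /=.
  apply/esym/eqP; rewrite eqr_nat eqb1.
  (* The kernel size is N minus multiples of d, one for each hue. *)
  have : (d %| N)%N by apply: dvdn_mulr.
  rewrite [X in (d %| X)%N](class_size_sum f) dvdn_addl // dvdn_sum // => c _.
  by rewrite rowE dvdn_mulr.
have [->|n0] := eqVneq (class_size rho f None) 0%N; first by rewrite mul0r.
have [c Nc] : exists c, ~ exists k, forall j, F c j = k.
  have : ~~ [forall c, forall j, F c j == F c z].
    apply: contra Ngood => /forallP h; apply/admissible_part_of; split.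
      by rewrite -cards_eq0 -(class_size_None d_gt0).
    by move=> c; exists (F c z) => j; have /forallP/(_ j)/eqP := h c.
  rewrite negb_forall => /existsP[c /forallPn[j Nj]]; exists c => -[k ck].
  by rewrite !ck eqxx in Nj.
rewrite (bigD1 c) //= [X in _ * (X * _)]big1 ?mul0r ?mulr0 // => k _.
apply/eqP; rewrite prodf_seq_eq0; apply: contra_notT Nc => /hasPn h; exists k => j.
by apply/eqP; have := h j (mem_index_enum j); rewrite /= pnatr_eq0 eqb0 negbK.
Qed.

(** Generating coefficients indexed by size divided by d: the first for a kernel of size d i, the
    next for one hue whose d residue classes have size i, with r tones available in each. *)
Definition zero_coef (i : nat) : rat := (d * i)`!%:R^-1.
Definition block_coef (i : nat) : rat := r%:R ^+ (d * i) / i`!%:R ^+ d.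

(** Kernel and hues contribute independent factors, all of them polynomials in X^d; the count is
    read off at X^(d n). *)
Lemma card_admissible : #|[set f : coloring N s m | admissible d (part_of f)]|%:R =
  N`!%:R * series_mul (series_from 1 zero_coef) (series_expn block_coef m) n.
Proof.
have dN k : (k <= n)%N -> (k < N.+1)%N by move=> le_kn; rewrite ltnS (leq_trans le_kn) // leq_pmull.
have s_gt0 : (0 < s)%N by rewrite muln_gt0 d_gt0.
have d_dvd_s : (d %| s)%N by apply: dvdn_mulr.
rewrite -sum1dep_card big_mkcond natr_sum /=.
rewrite (eq_bigr (fun f => \sum_k \prod_x size_weight k x (class_size rho f x))); last first.
  by move=> f _; rewrite -admissible_size_weight; case: ifP.
rewrite exchange_big /=.
rewrite (eq_bigr (fun k => N`!%:R * (\prod_x egf N.+1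
    (fun t => #|[set u | rho u == x]|%:R ^+ t * size_weight k x t))`_N)); last first.
  move=> k _; apply: sum_color_classes => -[[c j]|] t le_Nt /=.
    by rewrite gtn_eqF //; apply: leq_trans le_Nt; apply: dN; rewrite -ltnS.
  by rewrite [(t <= _)%N]leqNgt le_Nt andbF.
rewrite -mulr_sumr; congr (_ * _); rewrite -coef_sum.
pose E := \poly_(i < n.+1) series_from 1 zero_coef i.
pose F := \poly_(i < n.+1) block_coef i.
have egf0 k : egf N.+1 (fun t => #|[set u | rho u == None]|%:R ^+ t * size_weight k None t) =
    E \Po 'X^d.
  apply/polyP => i; rewrite coef_comp_poly_Xn // !coef_poly card_residue_None expr1n mul1r /=.
  rewrite ltnS; case: (boolP (d %| i)%N) => [/dvdnP[j ->]|_]; last first.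
    by rewrite !andbF mul0r if_same.
  rewrite mulnK // /N [(j * d)%N]mulnC leq_pmul2l // ltnS muln_gt0 d_gt0 /=.
  rewrite /series_from /zero_coef; case: (leqP j n) => // _.
  by rewrite andbT; case: (0 < j)%N; rewrite ?mul1r ?mul0r.
(* The size of this class is prescribed, so its generating function is a monomial; the class has s /
   d = r colors. *)
have egf1 k c j : egf N.+1 (fun t => #|[set u | rho u == Some (c, j)]|%:R ^+ t *
    size_weight k (Some (c, j)) t) = (r%:R ^+ k c / (k c)`!%:R) *: 'X^(k c).
  rewrite card_residue_Some // /s mulKn //.
  apply/polyP => i; rewrite coefZ coefXn coef_poly /=.
  case: eqP => [->|_]; last by rewrite mulr0 mul0r mulr0 if_same.
  by rewrite dN ?mulr1 // -ltnS.
rewrite (eq_bigr (fun k : {ffun 'I_m -> 'I_n.+1} => (E \Po 'X^d) *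
    \prod_c (block_coef (k c) *: 'X^(d * k c)))); last first.
  move=> k _; rewrite prod_option egf0; congr (_ * _).
  rewrite (eq_bigr (fun x => (r%:R ^+ k x.1 / (k x.1)`!%:R) *: 'X^(k x.1))); last first.
    by move=> [c j] _; apply: egf1.
  rewrite -(pair_bigA _ (fun c (j : 'I_d) => (r%:R ^+ k c / (k c)`!%:R) *: 'X^(k c))) /=.
  apply: eq_bigr => c _.
  rewrite prodr_const card_ord exprZn -exprM [(k c * d)%N]mulnC; congr (_ *: _).
  by rewrite expr_div_n -exprM [(k c * d)%N]mulnC.
(* Summing over all prescriptions [k] yields one factor F(X^d) for each of the m hues. *)
rewrite -mulr_sumr -(bigA_distr_bigA (fun c (k : 'I_n.+1) => block_coef k *: 'X^(d * k))) /=.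
have FX : F \Po 'X^d = \sum_(k < n.+1) block_coef k *: 'X^(d * k).
  rewrite /F poly_def raddf_sum /=; apply: eq_bigr => k _.
  by rewrite linearZ /= rmorphXn /= comp_polyX -exprM.
rewrite -FX prodr_const card_ord -rmorphXn -rmorphM /= coef_comp_poly_Xn //.
rewrite dvdn_mulr // mulKn //.
apply: coef_mul_poly_series => i le_in.
  by rewrite coef_poly ltnS le_in.
apply: (coef_exp_poly_series (n := n)) => // j le_jn.
by rewrite coef_poly ltnS le_jn.
Qed.

End Count.

(** Both sides are polynomials in a, and for a = m both count the admissible colorings with m
    hues. *)
Lemma sum_admissible_weight (d r n : nat) (a : rat) : (0 < d)%N -> (0 < r)%N ->
  \sum_(w : dowling (d * n) (d * r) | admissible d (repr w)) weight (d * r) #|blocks (repr w)| a =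
  (d * n)`!%:R * series_mul (series_from 1 (zero_coef d)) (series_rpow (block_coef d r) a) n.
Proof.
move=> d_gt0 r_gt0; set s := (d * r)%N; set N := (d * n)%N.
have s_gt0 : (0 < s)%N by rewrite muln_gt0 d_gt0.
have d_dvd_s : (d %| s)%N by apply: dvdn_mulr.
pose p := \sum_(w : dowling N s | admissible d (repr w)) weight_poly s #|blocks (repr w)|.
pose q := N`!%:R *: \sum_(i < n.+1) series_from 1 (zero_coef d) i *:
  series_rpow_poly (block_coef d r) (n - i).
have pE b : p.[b] = \sum_(w : dowling N s | admissible d (repr w)) weight s #|blocks (repr w)| b.
  by rewrite horner_sum; apply: eq_bigr => w _; rewrite horner_weight_poly.
have qE b : q.[b] = N`!%:R *
    series_mul (series_from 1 (zero_coef d)) (series_rpow (block_coef d r) b) n.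
  rewrite hornerZ horner_sum; congr (_ * _); apply: eq_bigr => i _.
  by rewrite hornerZ horner_series_rpow_poly.
rewrite -pE -qE; congr (_.[_]); apply: poly_eq_nat => m; rewrite pE qE.
have eq_rpow : series_rpow (block_coef d r) m%:R =1 series_expn (block_coef d r) m.
  move=> i; apply: series_rpow_nat.
  by rewrite /block_coef muln0 expr0 fact0 expr1n divr1.
rewrite (eq_series_mul (frefl _) eq_rpow) -card_admissible //.
rewrite (eq_bigr (fun w : dowling N s =>
   (#|zmod s| ^ #|blocks (repr w)| * m ^_ #|blocks (repr w)|)%:R)); last first.
  by move=> w _; rewrite weight_nat card_zmod.
rewrite -natr_sum -(sum_card_flat_of m (fun w => admissible d (repr w))); congr (_%:R).
by apply: eq_card => f; rewrite !inE admissible_repr.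
Qed.

(** * Passage to the stated power series *)

Unset Implicit Arguments.

Theorem corollary4p17 (d r : nat) (hd : (1 <= d)%N) (hr : (1 <= r)%N) :
  series_from 1 (fun n =>
    (dowling_mu (d * n) (d * r) d d [set ord0])%:~R *
      (d%:R ^+ n / ((d * n)`!%:R * r%:R ^+ ((d - 1) * n))))
  =1
  series_opp (series_mul
    (series_from 1 (fun n =>
       d%:R ^+ n / ((d * n)`!%:R * r%:R ^+ ((d - 1) * n))))
    (series_rpow
       (fun n => d%:R ^+ n * r%:R ^+ n / n`!%:R ^+ d)
       (- (d * r)%:R^-1))).
Proof.
(* Both series of the statement are those of [zero_coef] and [block_coef] with b x substituted for
   x. *)
move=> n; pose b : rat := d%:R / r%:R ^+ (d - 1).
have r_neq0 : r%:R != 0 :> rat by rewrite pnatr_eq0 -lt0n.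
have bX k : b ^+ k = d%:R ^+ k / r%:R ^+ ((d - 1) * k).
  by rewrite /b expr_div_n -exprM.
have zE k : d%:R ^+ k / ((d * k)`!%:R * r%:R ^+ ((d - 1) * k)) = zero_coef d k * b ^+ k.
  by rewrite bX /zero_coef invfM mulrCA.
have blE k : d%:R ^+ k * r%:R ^+ k / k`!%:R ^+ d = block_coef d r k * b ^+ k.
  have dk : (d * k = (d - 1) * k + k)%N by rewrite -{1}(subnK hd) mulnDl mul1n.
  by rewrite bX /block_coef dk exprD [RHS]mulrC -!mulrA mulKf ?expf_neq0.
rewrite {1}/series_from /series_opp; have [n_gt0 | ] := ltnP 0 n; last first.
  by rewrite leqn0 => /eqP ->; rewrite /series_mul big_ord1 mul0r oppr0.
rewrite zE (dowling_muE _ hd) ?muln_gt0 ?hd ?dvdn_mulr //.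
rewrite sum_admissible_weight // mulNr; congr (- _).
(* The factor 1/(d n)! on the left cancels the (d n)! of the coloring count; only b^n remains to be
   distributed. *)
rewrite /zero_coef mulrCA mulrA mulrA mulVf ?mul1r ?pnatr_eq0 -?lt0n ?fact_gt0 //.
rewrite -series_mul_scale; apply: eq_series_mul => i.
  by rewrite /series_from; case: ifP => _; rewrite ?mul0r ?zE.
rewrite -series_rpow_scale; apply: eq_bigr => k _; congr (_ * _).
by apply: eq_series_expn => j; rewrite /series_from blE.
Qed.
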